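(* Let $G \leq \operatorname{SL}_d(\mathbb{Z})$ be a group generated by finitely many unipotent elements. Let $\widetilde{Y} \subset [0,1)^d$ be infinite such that for all distinct $\widetilde{y}, \widetilde{y}' \in \widetilde{Y}$ we have that $\widetilde{y} - \widetilde{y}'$ is not contained in any $G$-invariant proper affine subspace of $\mathbb{R}^d$. Then for all $\epsilon>0$ there exists a constant $k$ such that if $|\widetilde{Y}|>k$ then there exists $g \in G$ such that $gY$ is $\epsilon$-dense in $\mathbb{T}^d$, where $Y \subset \mathbb{T}^d$ is the projection of $\widetilde{Y}$ onto $\mathbb{T}^d$.
   Context: $\mathbb{T}^d=\mathbb{R}^d/\mathbb{Z}^d$, on which $\operatorname{SL}_d(\mathbb{Z})$ acts by matrix multiplication; the projection onto $\mathbb{T}^d$ is the quotient map $\mathbb{R}^d\to\mathbb{T}^d$. A proper affine subspace of $\mathbb{R}^d$ is a set of the form $W+b$ with $W$ a linear subspace, $b\in\mathbb{R}^d$, and $W+b\ne\mathbb{R}^d$ (single points are allowed, with $W=0$); it is $G$-invariant if $g(W+b)\subset W+b$ for all $g\in G$. For $u\in\mathbb{T}^d$, $|u|$ denotes the $\|\cdot\|_\infty$-distance from the origin of $\mathbb{R}^d$ to the closest point of the preimage of $u$ in $\mathbb{R}^d$. A subset $Z\subset\mathbb{T}^d$ is $\epsilon$-dense if for every $\alpha\in\mathbb{T}^d$ there is $z\in Z$ with $|\alpha-z|\le\epsilon$. *)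

(* Defs.v *)
From HB Require Import structures.
From mathcomp Require Import all_boot all_order all_algebra.
From mathcomp Require Import all_classical all_reals all_analysis.
Set Implicit Arguments.
Unset Strict Implicit.
Unset Printing Implicit Defensive.
Import Order.TTheory GRing.Theory Num.Theory.
Import numFieldNormedType.Exports.
Local Open Scope classical_set_scope.
Local Open Scope ring_scope.
Local Open Scope quotient_scope.

(* H <= SL_d(Z), as a set of integer matrices. *)
Definition SLZ_subgroup (d : nat) (H : set 'M[int]_d) : Prop :=
  [/\ forall g, H g -> \det g = 1,
      H 1%:M,
      forall g h, H g -> H h -> H (g *m h) &
      forall g, H g -> H (invmx g)].

(* The subgroup of SL_d(Z) generated by S, for S contained in SL_d(Z).
   If S is not contained in SL_d(Z) this is an empty intersection, i.e. setT. *)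
Definition SLZ_generated (d : nat) (S : set 'M[int]_d) : set 'M[int]_d :=
  smallest (@SLZ_subgroup d) S.

Definition unipotent (d : nat) (u : 'M[int]_d) : Prop :=
  exists n : nat, (u - 1%:M) ^+ n = 0.

Section LinearAction.
Variables (R : realType) (d : nat).

Definition lin_act (g : 'M[int]_d) (v : 'cV[R]_d) : 'cV[R]_d :=
  map_mx intr g *m v.

Definition affine_subspace (W : {vspace 'cV[R]_d}) (b : 'cV[R]_d) :
  set 'cV[R]_d := [set w + b | w in [set w | w \in W]].

Definition proper_affine (A : set 'cV[R]_d) : Prop :=
  (exists W b, A = affine_subspace W b) /\ A <> setT.

Definition invariant_under (G : set 'M[int]_d) (A : set 'cV[R]_d) : Prop :=
  forall g, G g -> lin_act g @` A `<=` A.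

Definition half_open_cube : set 'cV[R]_d :=
  [set v | forall i, 0 <= v i 0 < 1].

End LinearAction.

Section Torus.
Variables (R : realType) (d : nat).

Definition int_lattice (v : 'cV[R]_d) : bool :=
  [forall i, v i 0 \is a Num.int].

Lemma int_lattice_zmod_closed : zmod_closed int_lattice.
Proof.
split; first by apply/forallP => i; rewrite mxE rpred0.
move=> x y /forallP xZ /forallP yZ; apply/forallP => i.
by rewrite !mxE rpredB ?xZ ?yZ.
Qed.

HB.instance Definition _ :=
  GRing.isZmodClosed.Build 'cV[R]_d int_lattice int_lattice_zmod_closed.

Let Zd : zmodClosed 'cV[R]_d := GRing.ZmodClosed.clone _ int_lattice _.

Definition torus : zmodType := Quotient.quot Zd.

Definition torus_proj (v : 'cV[R]_d) : torus := \pi_(Quotient.quot Zd) v.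

Definition torus_lift (u : torus) : 'cV[R]_d :=
  repr (u : Quotient.quot Zd).

(* The value does not depend on the choice of the lift: see torus_actE. *)
Definition torus_act (g : 'M[int]_d) (u : torus) : torus :=
  torus_proj (lin_act g (torus_lift u)).

Lemma torus_projE (v w : 'cV[R]_d) :
  torus_proj v = torus_proj w <-> int_lattice (v - w).
Proof.
have vwE : int_lattice (v - w) = (torus_proj v == torus_proj w).
  exact: (Quotient.idealrBE Zd v w).
by rewrite vwE; split => /eqP.
Qed.

Lemma torus_projB (v w : 'cV[R]_d) :
  torus_proj (v - w) = torus_proj v - torus_proj w.
Proof. exact: (raddfB \pi_(Quotient.quot Zd)). Qed.

Lemma torus_liftK (u : torus) : torus_proj (torus_lift u) = u.
Proof. exact: (reprK (u : Quotient.quot Zd)). Qed.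

Lemma torus_actE (g : 'M[int]_d) (v : 'cV[R]_d) :
  torus_act g (torus_proj v) = torus_proj (lin_act g v).
Proof.
apply/torus_projE; rewrite /lin_act -mulmxBr.
have /torus_projE/forallP vZ := torus_liftK (torus_proj v).
apply/forallP => i; rewrite mxE rpred_sum // => j _.
by rewrite rpredM ?vZ // mxE intr_int.
Qed.

(* On 'cV[R]_d the library norm `|v| is the sup norm. *)
Definition torus_norm (u : torus) : R :=
  inf [set `|v| | v in [set v : 'cV[R]_d | torus_proj v = u]].

Definition eps_dense (eps : R) (Z : set torus) : Prop :=
  forall a : torus, exists2 z, Z z & torus_norm (a - z) <= eps.

End Torus.

(* Main.v *)
Require Import Defs.
From HB Require Import structures.
From mathcomp Require Import all_boot all_order all_algebra.
From mathcomp Require Import all_classical all_reals all_analysis.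
From mathcomp Require Import ring lra zify.
Set Implicit Arguments.
Unset Strict Implicit.
Unset Printing Implicit Defensive.
Import Order.TTheory GRing.Theory Num.Theory.
Import numFieldNormedType.Exports.
Local Open Scope classical_set_scope.
Local Open Scope ring_scope.

(** The proof is a second moment argument on finitely many points of [Yt].

    Fix a frequency [m != 0] in [Z ^ d] and points [y 0, .., y (k - 1)] of [Yt].
    Expanding a square, the average over [g] of
    [|\sum_i exp (2 i pi m . g (y i))| ^ 2] is the sum over the pairs [(i, j)] of
    the averages of [exp (2 i pi m . g (y i - y j))].  If those with [i != j] are
    small, then for some [g] all the exponential sums are small compared with
    [k], simultaneously for any prescribed finite set of frequencies.  A
    trigonometric polynomial with positive constant term that is nonpositive
    outside the cube of radius [eps] around the lattice
    ([trig_poly_localized]) converts this into density: if no [g (y i)] were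
    close to a given point, its sum over the [g (y i)], recentred at that point,
    would be nonpositive, although its constant term dominates the sum.

    The group need not be amenable, so [g] runs over a polynomial family
    [g : A -> G] indexed by a commutative monoid [A], a product of powers of
    unipotent elements, for which [a |-> m . g a z] is a polynomial map.  Such a
    family can be chosen large enough to span the same matrices as [G]
    ([spanning_family]).  By a Weyl type theorem ([weyl_periodic]), the averages
    of [exp (2 i pi p)], for a polynomial map [p], are small unless [p] is
    periodic modulo one with a period [Q] that depends only on the degree and on
    the required bound.

    It remains to find arbitrarily many points of [Yt] all of whose differences
    give small averages.  For a given [y0], only finitely many [y] are bad
    ([finite_exceptional]): for bad [y], the differences of
    [a |-> m . g a (y - y0)] along [Q] are bounded integers, so that infinitely
    many bad points would contain two, [y] and [y'], with the same integers.
    Then [a |-> m . g a (y' - y)] is constant, and [y' - y] lies in the proper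
    invariant affine subspace of all [v] such that [m . h v] has this constant
    value for every [h] in [G], which the hypothesis on differences excludes.
    Points are then selected greedily ([greedy_selection]). *)

(** * Polynomial maps on a commutative monoid *)

Section PolynomialMaps.

Definition fdiff (A : nmodType) (V : zmodType) (h : A) (p : A -> V) : A -> V :=
  fun x => p (x + h) - p x.

(** [polydeg D p] means that [p] is a polynomial map of degree strictly less
    than [D]: only the zero map has [D = 0].  The definition through iterated
    differences makes sense on any commutative monoid [A], so that families
    with several exponents are treated like families with one. *)
Fixpoint polydeg (A : nmodType) (V : zmodType) (D : nat) (p : A -> V) : Prop :=
  match D with
  | 0 => forall x, p x = 0
  | D'.+1 => forall h, polydeg D' (fdiff h p)
  end.

Lemma polydegS (A : nmodType) (V : zmodType) D (p : A -> V) :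
  polydeg D p -> polydeg D.+1 p.
Proof.
elim: D p => [|D IH] p /= p0 h; last exact/IH/p0.
by move=> x; rewrite /fdiff !p0 subr0.
Qed.

Lemma polydeg_le (A : nmodType) (V : zmodType) D E (p : A -> V) :
  (D <= E)%N -> polydeg D p -> polydeg E p.
Proof.
move=> /subnK <-; elim: (E - D)%N => // n IH Hp.
by rewrite addSn; apply/polydegS/IH.
Qed.

Lemma polydeg_cst (A : nmodType) (V : zmodType) (c : V) :
  polydeg 1 (fun _ : A => c).
Proof. by move=> h x; rewrite /fdiff subrr. Qed.

Lemma polydegD (A : nmodType) (V : zmodType) D (p q : A -> V) :
  polydeg D p -> polydeg D q -> polydeg D (fun x => p x + q x).
Proof.
elim: D p q => [|D IH] p q /= Hp Hq => [x|h]; first by rewrite Hp Hq addr0.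
have -> : fdiff h (fun x => p x + q x) = fun x => fdiff h p x + fdiff h q x.
  by apply/funext => x; rewrite /fdiff opprD addrACA.
exact: IH.
Qed.

Lemma polydeg_shift (A : nmodType) (V : zmodType) D (p : A -> V) h :
  polydeg D p -> polydeg D (fun x => p (x + h)).
Proof.
elim: D p => [|D IH] p /= Hp => [x|k]; first exact: Hp.
have -> : fdiff k (fun x => p (x + h)) = fun x => fdiff k p (x + h).
  by apply/funext => x; rewrite /fdiff addrAC.
exact: IH.
Qed.

Lemma polydeg_comp (A B : nmodType) (V : zmodType) D (p : A -> V)
    (f : {additive B -> A}) :
  polydeg D p -> polydeg D (fun x => p (f x)).
Proof.
elim: D p => [|D IH] p /= Hp => [x|k]; first exact: Hp.
have -> : fdiff k (fun x => p (f x)) = fun x => fdiff (f k) p (f x).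
  by apply/funext => x; rewrite /fdiff raddfD.
exact: IH.
Qed.

Lemma polydeg_additive (A : nmodType) (V W : zmodType) D (p : A -> V)
    (f : V -> W) (fB : forall u v, f (u - v) = f u - f v) :
  polydeg D p -> polydeg D (fun x => f (p x)).
Proof.
elim: D p => [|D IH] p /= Hp => [x|k].
  by rewrite Hp -(subrr 0) fB subrr.
have -> : fdiff k (fun x => f (p x)) = fun x => f (fdiff k p x).
  by apply/funext => x; rewrite /fdiff fB.
exact: IH.
Qed.

(** Leibniz rule,
    [fdiff h (p q) x = fdiff h p x * q (x + h) + p x * fdiff h q x],
    and induction on both degrees. *)
Lemma polydeg_mulmx (A : nmodType) (K : pzRingType) (d D E : nat)
    (p q : A -> 'M[K]_d) :
  polydeg D p -> polydeg E q -> polydeg (D + E)%N (fun x => p x *m q x).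
Proof.
elim: D E p q => [|D IHD] E p q Hp Hq.
  by apply: (@polydeg_le _ _ 0) => // x; rewrite /= Hp mul0mx.
elim: E q Hq => [|E IHE] q Hq.
  by apply: (@polydeg_le _ _ 0) => // x; rewrite /= Hq mulmx0.
rewrite addSn => h.
have -> : fdiff h (fun x => p x *m q x) =
    fun x => fdiff h p x *m q (x + h) + p x *m fdiff h q x.
  by apply/funext => x; rewrite /fdiff mulmxBl mulmxBr addrA subrK.
apply: polydegD; first by apply: IHD; [exact: Hp | exact: polydeg_shift].
by have := IHE _ (Hq h); rewrite addSnnS.
Qed.

(** The difference of the map by [h] gains a factor [u ^+ h - 1], a multiple
    of [u - 1], so nilpotency of [u - 1] bounds the degree. *)
Lemma polydeg_unipotent_pow (K : pzRingType) (D : nat) (w u : K) :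
  w * (u - 1) ^+ D = 0 -> polydeg D (fun n : nat => w * u ^+ n).
Proof.
elim: D w => [|D IH] w Hw => [x|h].
  by move: Hw; rewrite expr0 mulr1 => ->; rewrite mul0r.
have -> : fdiff h (fun n : nat => w * u ^+ n) =
    fun n => (w * (u ^+ h - 1)) * u ^+ n.
  apply/funext => n; rewrite /fdiff -mulrBr -mulrA; congr (_ * _).
  by rewrite -[X in _ - X]mul1r [(n + h)%R]addrC exprD mulrBl.
apply: IH; rewrite subrX1 mulrA -mulrA.
set S := \sum_(i < h) _.
have cS : GRing.comm S (u - 1).
  apply/commr_sym/commr_sum => i _; apply/commrX/commr_sym/commrB => //.
  exact: commr1.
by rewrite (commrX D cS) mulrA -(mulrA w) -exprS Hw mul0r.
Qed.

End PolynomialMaps.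

(** * Averages of trigonometric functions of a polynomial map *)

Section Weyl.
Variable R : realType.
Implicit Types (A : nmodType) (d : R).

Lemma cos_mod_int (a x y : R) : x - y \is a Num.int ->
  cos (2 * pi * x + a) = cos (2 * pi * y + a).
Proof.
move=> /intrP[n Hn].
have -> : x = y + n%:~R by lra.
suff H : forall (k : nat) (z : R),
    cos (2 * pi * (z + k%:R) + a) = cos (2 * pi * z + a).
  case: n {Hn} => k; first exact: H.
  by rewrite NegzE -[in RHS](subrK (k.+1%:R) y) H rmorphN.
elim=> [|k IH] z; first by rewrite addr0.
rewrite -natr1 -[RHS]IH -[RHS](cosD2pi _); congr cos.
by rewrite mulrnAl; ring.
Qed.

(** For every phase [th] the left-hand side is at most the squared modulus of
    the exponential sum with arguments [a i], which is the right-hand side. *)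
Lemma cos_sum_sq (I : Type) (r : seq I) (a : I -> R) (th : R) :
  (\sum_(i <- r) cos (a i + th)) ^+ 2 <=
  \sum_(i <- r) \sum_(j <- r) cos (a i - a j).
Proof.
set C := \sum_(i <- r) cos (a i); set S := \sum_(i <- r) sin (a i).
have -> : \sum_(i <- r) cos (a i + th) = C * cos th - S * sin th.
  by rewrite !mulr_suml -sumrB; apply: eq_bigr => i _; rewrite cosD.
have -> : \sum_(i <- r) \sum_(j <- r) cos (a i - a j) = C ^+ 2 + S ^+ 2.
  rewrite !expr2 !mulr_suml -big_split; apply: eq_bigr => i _ /=.
  by rewrite !mulr_sumr -big_split; apply: eq_bigr => j _ /=; rewrite cosB.
have := cos2Dsin2 th; set c := cos th; set s := sin th => cs.
have := sqr_ge0 (C * s + S * c).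
have -> : C ^+ 2 + S ^+ 2 = (C ^+ 2 + S ^+ 2) * (c ^+ 2 + s ^+ 2)
  by rewrite cs mulr1.
nra.
Qed.

(** Averages are taken over finite multisets of shifts, uniformly in the base
    point [x].  Uniformity in the phase [th] turns a bound on the real part into
    a bound on the modulus of the average of [exp (2 i pi p)], so no complex
    number is needed. *)
Definition small_average_on d A (s : seq A) (p : A -> R) : Prop := forall x th,
  \sum_(h <- s) cos (2 * pi * p (x + h) + th) <= d * (size s)%:R.

Definition small_average d A (p : A -> R) : Prop :=
  exists2 s : seq A, s != [::] & small_average_on d s p.

Lemma sum_le_size (I : eqType) (r : seq I) (F : I -> R) c :
  (forall i, i \in r -> F i <= c) -> \sum_(i <- r) F i <= c * (size r)%:R.
Proof.
elim: r => [|i r IH] H; first by rewrite big_nil mulr0.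
rewrite big_cons /= -natr1 mulrDr mulr1 addrC lerD ?H ?mem_head //.
by apply: IH => j jr; rewrite H // in_cons jr orbT.
Qed.

(** Averaging an already small average over further shifts keeps it small: this
    is where the uniformity in the base point and the commutativity of [A] are
    used. *)
Lemma small_average_on_sums d A (s t : seq A) (p : A -> R) :
  small_average_on d s p \/ small_average_on d t p ->
  small_average_on d [seq a + b | a <- s, b <- t] p.
Proof.
have E : forall F : A -> R, \sum_(h <- [seq a + b | a <- s, b <- t]) F h =
   \sum_(a <- s) \sum_(b <- t) F (a + b).
  by move=> F; rewrite (big_allpairs_dep).
case=> H x th; rewrite size_allpairs E.
  rewrite exchange_big /= natrM mulrA; apply: sum_le_size => b _.
  have := H (x + b) th; congr (_ <= _); apply: eq_bigr => a _.
  by rewrite (addrC a) addrA.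
rewrite mulnC natrM mulrA; apply: sum_le_size => a _.
have := H (x + a) th; congr (_ <= _); apply: eq_bigr => b _.
by rewrite addrA.
Qed.

Lemma small_average_on_common d A (I : eqType) (r : seq I) (P : I -> A -> R) :
  (forall i, i \in r -> small_average d (P i)) ->
  exists2 s : seq A, s != [::] &
    forall i, i \in r -> small_average_on d s (P i).
Proof.
elim: r => [|i r IH] H; first by exists [:: 0].
have [|s s0 Hs] := IH; first by move=> j jr; apply: H; rewrite in_cons jr orbT.
have [t t0 Ht] := H i (mem_head _ _).
exists [seq a + b | a <- s, b <- t].
  by rewrite -size_eq0 size_allpairs muln_eq0 !size_eq0 negb_or s0.
move=> j; rewrite in_cons => /orP[/eqP ->|jr]; apply: small_average_on_sums.
  by right.
by left; apply: Hs.
Qed.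

(** Van der Corput's inequality: averaging first over [0, h, .., (H - 1) h] and
    then over [s], Cauchy-Schwarz bounds the square of the average by an average
    over pairs [(i, j)] of the correlations of [p] with its shift by
    [(i - j) h].  The diagonal contributes [1 / H]. *)
Lemma small_average_van_der_corput d d' A (p : A -> R) (h : A) (H : nat) :
  0 < d -> 0 <= d' -> (0 < H)%N -> H%:R^-1 + d' <= d ^+ 2 ->
  (forall k, (0 < k < H)%N -> small_average d' (fdiff (h *+ k) p)) ->
  small_average d p.
Proof.
move=> d0 d'0 H0 Hd Hk.
have [|s s0 Hs] := @small_average_on_common d' A _ (iota 1 H.-1)
    (fun k => fdiff (h *+ k) p).
  by move=> k; rewrite mem_iota => k1; apply: Hk; move: k1; lia.
pose n : R := (size s)%:R.
have n0 : 0 < n by rewrite ltr0n lt0n size_eq0.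
have H0' : 0 < H%:R :> R by rewrite ltr0n.
have off0 : forall k : nat, (0 < k < H)%N -> forall x,
    \sum_(t <- s) cos (2 * pi * (p (x + t + h *+ k) - p (x + t))) <= d' * n.
  move=> k k1 x; have := Hs k _ x 0; rewrite mem_iota => /(_ _)/= E.
  have /E : (0 < k < 1 + H.-1)%N by move: k1; lia.
  congr (_ <= _); apply: eq_bigr => t _; rewrite addr0 /fdiff.
  by congr (cos (_ * (p _ - _))).
exists [seq t + h *+ i | t <- s, i <- iota 0 H].
  rewrite -size_eq0 size_allpairs muln_eq0 !size_eq0 negb_or s0.
  by case: (H) H0.
move=> x th; rewrite big_allpairs_dep size_allpairs size_iota natrM.
pose a t i := 2 * pi * p (x + (t + h *+ i)).
rewrite -[X in X <= _]/(\sum_(t <- s) \sum_(i <- iota 0 H) cos (a t i + th)).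
set b := fun t => \sum_(i <- iota 0 H) cos (a t i + th).
have CS : (\sum_(t <- s) b t) ^+ 2 <= n * \sum_(t <- s) b t ^+ 2.
  have : 0 <= \sum_(t <- s) \sum_(u <- s) (b t - b u) ^+ 2.
    by apply: sumr_ge0 => t _; apply: sumr_ge0 => u _; exact: sqr_ge0.
  have -> : \sum_(t <- s) \sum_(u <- s) (b t - b u) ^+ 2 =
     2 * (n * (\sum_(t <- s) b t ^+ 2) - (\sum_(t <- s) b t) ^+ 2).
    have -> : n * (\sum_(t <- s) b t ^+ 2) =
        \sum_(t <- s) \sum_(u <- s) b t ^+ 2.
      rewrite mulr_sumr; apply: eq_bigr => t _.
      by rewrite big_const_seq count_predT iter_addr_0 mulr_natl.
    rewrite expr2 mulr_suml mulrBr.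
    have E1 : \sum_(t <- s) \sum_(u <- s) b t ^+ 2 =
        \sum_(t <- s) \sum_(u <- s) b u ^+ 2.
      by rewrite exchange_big.
    rewrite [X in X - _]mulr_natl mulr2n {1}E1 -!big_split mulr_sumr -sumrB /=.
    apply: eq_bigr => t _; rewrite mulr_sumr mulr_sumr -big_split -sumrB /=.
    by apply: eq_bigr => u _; ring.
  by rewrite pmulr_rge0 // subr_ge0.
have B2 : \sum_(t <- s) b t ^+ 2 <= H%:R * (n + d' * n * H%:R).
  apply: (@le_trans _ _ (\sum_(t <- s) \sum_(i <- iota 0 H)
      \sum_(j <- iota 0 H) cos (a t i - a t j))).
    by apply: ler_sum => t _; exact: cos_sum_sq.
  rewrite exchange_big /= mulrC.
  have -> : H%:R = (size (iota 0 H))%:R :> R by rewrite size_iota.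
  apply: sum_le_size => i; rewrite mem_iota => /andP[_ iH].
  rewrite exchange_big /=.
  have off : forall j, j \in iota 0 H -> j != i ->
      \sum_(t <- s) cos (a t i - a t j) <= d' * n.
    move=> j; rewrite mem_iota => /andP[_ jH] ij.
    have [l|l] := ltnP i j.
      have := off0 (j - i)%N _ (x + h *+ i); have -> : (0 < j - i < H)%N by lia.
      move=> /(_ isT); congr (_ <= _); apply: eq_bigr => t _.
      rewrite -[LHS]cosN /a (_ : x + h *+ i + t = x + (t + h *+ i)).
        rewrite -(addrA x) -(addrA t) -mulrnDr subnKC 1?ltnW //.
        by congr cos; rewrite mulrBr opprB.
      by rewrite -addrA (addrC t).
    have {}l : (j < i)%N by rewrite ltn_neqAle ij.
    have := off0 (i - j)%N _ (x + h *+ j); have -> : (0 < i - j < H)%N by lia.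
    move=> /(_ isT); congr (_ <= _); apply: eq_bigr => t _.
    rewrite /a (_ : x + h *+ j + t = x + (t + h *+ j)).
      by rewrite -(addrA x) -(addrA t) -mulrnDr subnKC 1?ltnW // mulrBr.
    by rewrite -addrA (addrC t).
  apply: (@le_trans _ _ (\sum_(j <- iota 0 H) (d' * n + n * (j == i)%:R))).
    rewrite big_seq [X in _ <= X]big_seq; apply: ler_sum => j jr.
    have [->|ji] := eqVneq j i.
      rewrite (eq_bigr (fun => 1)) => [|t _]; last by rewrite subrr cos0.
      rewrite big_const_seq count_predT iter_addr_0 mulr1 lerDr.
      by rewrite mulr_ge0 // ltW.
    by rewrite mulr0 addr0 off.
  rewrite big_split /= addrC lerD //; last exact: sum_le_size.
  rewrite -mulr_sumr -natr_sum ler_piMr ?(ltW n0) //.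
  rewrite -[X in _ <= X]/(1%:R) ler_nat.
  rewrite -big_mkcond /= sum1_count count_uniq_mem ?iota_uniq //.
  by case: (_ \in _).
have : (\sum_(t <- s) b t) ^+ 2 <= (d * (n * H%:R)) ^+ 2.
  apply: (le_trans CS); apply: (le_trans (ler_wpM2l (ltW n0) B2)).
  have -> : n * (H%:R * (n + d' * n * H%:R)) =
      n ^+ 2 * H%:R ^+ 2 * (H%:R^-1 + d').
    by field; rewrite gt_eqF.
  have -> : (d * (n * H%:R)) ^+ 2 = n ^+ 2 * H%:R ^+ 2 * d ^+ 2 by ring.
  by apply: ler_wpM2l => //; rewrite mulr_ge0 ?sqr_ge0.
have dnH : 0 <= d * (n * H%:R) by rewrite !mulr_ge0 // ltW.
by clear -dnH; set B := d * _ in dnH *; set S := \sum_(t <- s) _; nra.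
Qed.

Lemma sin_pi_neq0 (psi : R) : psi \isn't a Num.int -> sin (pi * psi) != 0.
Proof.
move=> Hpsi; apply/eqP => s0.
have c1 : forall x : R, cos (2 * pi * x + 0) = 1 - 2 * sin (pi * x) ^+ 2.
  move=> x; have -> : 2 * pi * x + 0 = (pi * x) *+ 2 :> R by ring.
  by rewrite cos_mulr2n cos2sin2; ring.
have := @cos_mod_int 0 psi (psi - (Num.floor psi)%:~R) _.
rewrite opprB addrC subrK intr_int => /(_ isT).
rewrite !c1 s0.
set t := psi - _ => E.
have t0 : 0 < t < 1.
  have /andP[H1 H2] := floor_itv psi.
  rewrite /t subr_gt0 ltrBlDl -[X in _ + X]/(1%:~R) -intrD H2 andbT.
  rewrite lt_neqAle H1 andbT; apply: contraNneq Hpsi => <-.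
  exact: intr_int.
have : 0 < sin (pi * t).
  apply: sin_gt0_pi; have := pi_gt0 R; nra.
nra.
Qed.

(** Along the direction [y] the map is linear modulo one with a slope [psi] that
    is not an integer, so the sums are bounded geometric sums: multiplied by
    [2 sin (pi psi)] they telescope. *)
Lemma small_average_linear d A (p : A -> R) (y : A) (psi : R) :
  0 < d -> (forall x, p (x + y) - p x - psi \is a Num.int) ->
  psi \isn't a Num.int -> small_average d p.
Proof.
move=> d0 Hp /sin_pi_neq0 s0; set s := sin _ in s0.
pose T := (Num.truncn (d * `|s|)^-1).+1.
have T1 : 1 < d * `|s| * T%:R.
  have ds : 0 < d * `|s| by rewrite mulr_gt0 ?normr_gt0.
  by rewrite -(ltr_pdivrMl _ _ ds) mulr1 /T truncnS_gt.
exists [seq y *+ t | t <- iota 0 T]; first by [].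
move=> x th; rewrite size_map size_iota big_map.
have pt : forall t : nat, p (x + y *+ t) - (p x + t%:R * psi) \is a Num.int.
  elim=> [|t IH]; first by rewrite mul0r !addr0 subrr.
  have -> : p (x + y *+ t.+1) - (p x + t.+1%:R * psi) =
     (p (x + y *+ t + y) - p (x + y *+ t) - psi) +
     (p (x + y *+ t) - (p x + t%:R * psi)).
    by rewrite mulrSr addrA -natr1; ring.
  by rewrite rpredD.
pose f t : R := sin (2 * pi * (p x + t%:R * psi) + th - pi * psi).
have tel : 2 * s * (\sum_(t <- iota 0 T) cos (2 * pi * p (x + y *+ t) + th)) =
    f T - f 0%N.
  rewrite -(telescope_sumr f (leq0n T)) mulr_sumr /index_iota subn0.
  apply: eq_bigr => t _; rewrite (cos_mod_int _ (pt t)) /f.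
  set z := 2 * pi * _ + th.
  have -> : 2 * pi * (p x + t.+1%:R * psi) + th - pi * psi = z + pi * psi.
    by rewrite /z -natr1; ring.
  by rewrite sinB sinD /s; ring.
have le1 : `|s| * (\sum_(t <- iota 0 T) cos (2 * pi * p (x + y *+ t) + th)) <= 1.
  have : `|2 * s * (\sum_(t <- iota 0 T) cos (2 * pi * p (x + y *+ t) + th))| <= 2.
    rewrite tel; apply: (le_trans (ler_normB _ _)).
    have := sin_max (2 * pi * (p x + T%:R * psi) + th - pi * psi).
    have := sin_max (2 * pi * (p x + 0 * psi) + th - pi * psi).
    by rewrite /f; lra.
  rewrite !normrM [`|2|]ger0_norm //; set S := \sum_(t <- _) _.
  have := ler_norm S; have := normr_ge0 s; nra.
have s0' : 0 < `|s| by rewrite normr_gt0.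
rewrite -(ler_pM2l s0'); apply: (le_trans le1); move: T1; nra.
Qed.

Definition periodic_mod1 A (Q : nat) (p : A -> R) : Prop :=
  forall x y, p (x + y *+ Q) - p x \is a Num.int.

Lemma periodic_mod1M A (Q k : nat) (p : A -> R) :
  periodic_mod1 Q p -> periodic_mod1 (k * Q)%N p.
Proof. by move=> H x y; rewrite mulrnA; apply: H. Qed.

Lemma fdiff_muln A (V : zmodType) (p : A -> V) (h : A) (k : nat) (x : A) :
  fdiff (h *+ k) p x = \sum_(i < k) fdiff h p (x + h *+ i).
Proof.
elim: k => [|k IH]; first by rewrite big_ord0 /fdiff addr0 subrr.
by rewrite big_ord_recr /= -IH /fdiff mulrSr addrA [RHS]addrC subrKA.
Qed.

(** If all first differences [p (x + z) - p x] are, after multiplication by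
    [Q ^ D], independent of [x] modulo one, then [Q ^ D * p] is additive in
    [z] modulo one, and periodicity kills [Q] times it. *)
Lemma periodic_mod1_torsion A (Q D : nat) (p : A -> R) :
  polydeg D p -> periodic_mod1 Q p ->
  forall x, (Q ^ D)%:R * (p x - p 0) \is a Num.int.
Proof.
elim: D p => [|D IH] p Hp HQ z; first by rewrite !Hp subrr mulr0.
have Hz : forall x, (Q ^ D)%:R * (fdiff z p x - fdiff z p 0) \is a Num.int.
  move=> x; apply: IH; first exact: Hp.
  move=> u y; rewrite /fdiff.
  rewrite (_ : _ - _ = (p (u + z + y *+ Q) - p (u + z)) - (p (u + y *+ Q) - p u)).
    by rewrite rpredB.
  by rewrite (addrAC u); ring.
have E : fdiff (z *+ Q) p 0 = \sum_(i < Q) (fdiff z p (0 + z *+ i) - fdiff z p 0)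
    + Q%:R * fdiff z p 0.
  rewrite fdiff_muln -[in LHS](eq_bigr _ (fun i _ => subrK (fdiff z p 0) _)).
  by rewrite big_split /= sumr_const card_ord mulr_natl.
have -> : (Q ^ D.+1)%:R * (p z - p 0) = (Q ^ D)%:R * fdiff (z *+ Q) p 0 -
    \sum_(i < Q) (Q ^ D)%:R * (fdiff z p (0 + z *+ i) - fdiff z p 0).
  rewrite E -mulr_sumr [X in _ = X - _]mulrDr addrAC subrr add0r.
  by rewrite expnS natrM /fdiff add0r; ring.
rewrite rpredB // ?rpred_sum //.
by rewrite rpredM ?natr_int // /fdiff HQ.
Qed.

Lemma dvd_fact_mul (Q H k : nat) : (0 < k < H)%N -> (k %| Q * H`!)%N.
Proof. by move=> kH; apply/dvdn_mull/dvdn_fact; lia. Qed.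

(** A qualitative form of Weyl's inequality: the only obstruction to
    cancellation is being periodic modulo one, with a period depending only on
    the degree and on the required bound.

    By van der Corput, if the averages of [p] are not small, then every [h] has
    a multiple [k h], with [k] bounded, such that those of [fdiff (k h) p] are
    not small either; by induction the latter is periodic.  A common multiple
    [Q2] makes [fdiff (y *+ Q2) p] periodic modulo one with period [Q2] for each
    [y].  By [periodic_mod1_torsion], [Q2 ^ D] times it is constant modulo one,
    that is, [p] is linear modulo one in the direction [y *+ (Q2 ^ D * Q2)]; a
    slope that is not an integer would give small averages. *)
Lemma weyl_periodic (D : nat) (d : R) : 0 < d -> exists2 Q : nat, (0 < Q)%N &
  forall A (p : A -> R), polydeg D p -> ~ small_average d p -> periodic_mod1 Q p.
Proof.
elim: D d => [|D IH] d d0.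
  by exists 1%N => // A p Hp _ x y; rewrite !Hp subrr.
pose d' := d ^+ 2 / 2.
have d'0 : 0 < d' by rewrite divr_gt0 // exprn_gt0.
have [Q1 Q10 HQ1] := IH d' d'0.
(* With this [H] and [d'], van der Corput's bound [1 / H + d'] is below
   [d ^ 2]. *)
pose H := (Num.truncn d'^-1).+1.
have H1 : H%:R^-1 + d' <= d ^+ 2.
  have : H%:R^-1 < d'.
    by rewrite invf_plt ?posrE ?ltr0n // /H truncnS_gt.
  by rewrite /d'; lra.
pose Q2 := (Q1 * H`!)%N.
have Q20 : (0 < Q2)%N by rewrite muln_gt0 Q10 fact_gt0.
exists (Q2 ^ D * Q2)%N; first by rewrite muln_gt0 expn_gt0 Q20.
move=> A p Hp np.
have HQ2 : forall h, periodic_mod1 Q2 (fdiff (h *+ Q2) p).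
  move=> h.
  have [k [kH nk]] : exists k,
      (0 < k < H)%N /\ ~ small_average d' (fdiff (h *+ k) p).
    apply: contrapT => nk; apply: np.
    apply: (@small_average_van_der_corput d d' A p h H) => //.
      exact: ltW.
    by move=> k kH; apply: contrapT => ns; apply: nk; exists k.
  have Hk := HQ1 _ _ (Hp _) nk.
  have /dvdnP[j Hj] := dvd_fact_mul Q1 kH.
  move=> x y; rewrite /Q2 [in X in fdiff X]Hj [(j * k)%N]mulnC mulrnA !fdiff_muln.
  rewrite -sumrB rpred_sum // => i _.
  rewrite (addrAC x) [(Q1 * _)%N]mulnC.
  exact: (@periodic_mod1M _ _ _ (fdiff (h *+ k) p) Hk).
move=> x y; pose q := fdiff (y *+ Q2) p; pose psi := (Q2 ^ D)%:R * q 0.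
have Hpsi : forall z, p (z + y *+ (Q2 ^ D * Q2)) - p z - psi \is a Num.int.
  move=> z; rewrite -[p _ - p z]/(fdiff _ p z) mulnC mulrnA fdiff_muln -/q.
  have -> : \sum_(i < Q2 ^ D) q (z + y *+ Q2 *+ i) - psi =
      \sum_(i < Q2 ^ D) (q (z + y *+ i *+ Q2) - q z) + (Q2 ^ D)%:R * (q z - q 0).
    rewrite [X in _ = X + _]sumrB sumr_const card_ord mulrBr -[q z *+ _]mulr_natl subrKA.
    by congr (_ - _); apply: eq_bigr => i _; rewrite -!mulrnA mulnC.
  rewrite rpredD ?rpred_sum // => [i _|]; first exact: HQ2.
  by apply: periodic_mod1_torsion; [exact: Hp | exact: HQ2].
have [ipsi|npsi] := boolP (psi \is a Num.int).
  by rewrite -(subrK psi (_ - _)) rpredD.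
by case: np; exact: small_average_linear d0 Hpsi npsi.
Qed.

End Weyl.

(** * A trigonometric polynomial positive only near the lattice *)

Section Fejer.
Variables (R : realType) (d : nat).

Definition pairing (m : 'rV[int]_d) (v : 'cV[R]_d) : R :=
  (map_mx intr m *m v) 0 0.

Lemma pairingDl m1 m2 v : pairing (m1 + m2) v = pairing m1 v + pairing m2 v.
Proof. by rewrite /pairing raddfD mulmxDl mxE. Qed.
Lemma pairingNl m v : pairing (- m) v = - pairing m v.
Proof. by rewrite /pairing raddfN mulNmx mxE. Qed.
Lemma pairingDr m v w : pairing m (v + w) = pairing m v + pairing m w.
Proof. by rewrite /pairing mulmxDr mxE. Qed.
Lemma pairingNr m v : pairing m (- v) = - pairing m v.
Proof. by rewrite /pairing mulmxN mxE. Qed.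
Lemma pairing_delta i v : pairing (delta_mx 0 i) v = v i 0.
Proof. by rewrite /pairing map_delta_mx -rowE mxE. Qed.

Definition trig_value (L : seq (R * 'rV[int]_d)) (x : 'cV[R]_d) : R :=
  \sum_(l <- L) l.1 * cos (2 * pi * pairing l.2 x).

Definition trig_mean (L : seq (R * 'rV[int]_d)) : R :=
  \sum_(l <- L | l.2 == 0) l.1.

(** [F] is a real trigonometric polynomial with constant term [c]. *)
Definition trig_poly (F : 'cV[R]_d -> R) (c : R) : Prop :=
  exists2 L, F =1 trig_value L & c = trig_mean L.

Lemma trig_poly_sum (I : Type) (r : seq I) (F : I -> 'cV[R]_d -> R) (c : I -> R) :
  (forall i, trig_poly (F i) (c i)) ->
  trig_poly (fun x => \sum_(i <- r) F i x) (\sum_(i <- r) c i).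
Proof.
move=> H; elim: r => [|i r [L HF Hc]].
  by exists [::] => [x|]; rewrite /trig_value /trig_mean !big_nil.
have [K KF Kc] := H i.
exists (K ++ L) => [x|].
  by rewrite /trig_value big_cat big_cons KF HF.
by rewrite /trig_mean big_cat big_cons Kc Hc.
Qed.

Lemma trig_polyD F G a b : trig_poly F a -> trig_poly G b ->
  trig_poly (fun x => F x + G x) (a + b).
Proof.
move=> [K KF Kc] [L LF Lc]; exists (K ++ L) => [x|].
  by rewrite /trig_value big_cat KF LF.
by rewrite /trig_mean big_cat Kc Lc.
Qed.

Lemma trig_poly_cos (c : R) m :
  trig_poly (fun x => c * cos (2 * pi * pairing m x)) (c * (m == 0)%:R).
Proof.
exists [:: (c, m)] => [x|]; first by rewrite /trig_value big_seq1.
by rewrite /trig_mean big_mkcond big_seq1 /=; case: eqP; rewrite ?mulr1 ?mulr0.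
Qed.

Definition freq n (J : {ffun 'I_d -> 'I_n}) : 'rV[int]_d := \row_i (J i : nat)%:Z.

Lemma freq_inj n : injective (@freq n).
Proof.
move=> J K /rowP E; apply/ffunP => i; apply/val_inj.
by have := E i; rewrite !mxE => -[].
Qed.

(** A proportion [1 - 1 / n] of the points of the box [{0, .., n - 1} ^ d]
    remains in the box when its [i]-th coordinate is increased by one. *)
Lemma count_unit_shifts n (i : 'I_d) :
  n%:R * \sum_(J : {ffun 'I_d -> 'I_n}) \sum_(K : {ffun 'I_d -> 'I_n})
    (freq J - freq K + delta_mx 0 i == 0)%:R >=
  (n%:R - 1) * #|{: {ffun 'I_d -> 'I_n}}|%:R :> R.
Proof.
case: n => [|n]; first by rewrite mul0r sub0r mulN1r oppr_le0 ler0n.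
pose h (l : 'I_d) (j : 'I_n.+1) : R := if l == i then (j < n)%:R else 1.
(* [\prod_l h l (J l)] is the indicator of [J i < n]; written as a product, it
   is summed by distributivity. *)
apply: (@le_trans _ _ (n.+1%:R * \sum_(J : {ffun 'I_d -> 'I_n.+1}) \prod_l h l (J l))).
  rewrite -bigA_distr_bigA (bigD1 i) //= -sum1_card natr_sum.
  have -> : \sum_(J in {: {ffun 'I_d -> 'I_n.+1}}) (1%:R : R) =
      \prod_(l < d) \sum_(j < n.+1) 1.
    rewrite bigA_distr_bigA; apply: eq_bigr => J _.
    by rewrite big1.
  have -> : \prod_(l < d | l != i) \sum_(j < n.+1) h l j =
      \prod_(l < d | l != i) \sum_(j < n.+1) 1.
    apply: eq_bigr => l li; apply: eq_bigr => j _.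
    by rewrite /h (negbTE li).
  rewrite [X in _ * X](bigD1 i) //=; set P := \prod_(l < d | _) _.
  have -> : \sum_(j < n.+1) h i j = n%:R :> R.
    rewrite big_ord_recr /= /h eqxx ltnn addr0 (eq_bigr (fun => 1)) => [|j _].
      by rewrite sumr_const card_ord.
    by rewrite /= ltn_ord.
  by rewrite sumr_const card_ord -natr1 addrK; lra.
apply: ler_wpM2l; first exact: ler0n.
apply: ler_sum => J _.
have [Ji|Ji] := boolP (J i < n)%N; last first.
  by rewrite (bigD1 i) //= {1}/h eqxx (negbTE Ji) mul0r sumr_ge0.
pose K := [ffun l => if l == i then inord (J i).+1 else J l].
rewrite [X in _ <= X](bigD1 K) //= [X in X <= _]big1 => [|l _]; last first.
  by rewrite /h; case: eqP => // ->; rewrite Ji.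
suff -> : freq J - freq K + delta_mx 0 i = 0 by rewrite eqxx lerDl sumr_ge0.
apply/rowP => l; rewrite !mxE ffunE eqxx /=.
have [->|li] := eqVneq; last by rewrite subrr addr0.
by rewrite inordK ?ltnS // -(addn1 (J i)) PoszD opprD addrA subrr sub0r addNr.
Qed.

Lemma cos_far_from_int (e t : R) : 0 < e <= 4^-1 ->
  (forall k : int, e < `|t - k%:~R|) -> cos (2 * pi * t) <= cos (2 * pi * e).
Proof.
move=> /andP[e0 e4] Ht.
pose k := Num.floor (t + 2^-1).
have -> : cos (2 * pi * t) = cos (2 * pi * (t - k%:~R)).
  have := @cos_mod_int R 0 t (t - k%:~R); rewrite !addr0; apply.
  by rewrite opprB addrC subrK intr_int.
have := Ht k; set u := t - _ => ue.
have u2 : `|u| <= 2^-1.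
  have /andP[] := floor_itv (t + 2^-1); rewrite -/k intrD ler_norml /u.
  lra.
rewrite -(cos_norm (2 * pi * u)) normrM [`|2 * pi|]ger0_norm; last first.
  by rewrite mulr_ge0 // pi_ge0.
have := pi_gt0 R => pi0.
by rewrite le_eqVlt ltr_cos ?orbT // ?in_itv /=; nra.
Qed.

(** Multiply the nonnegative kernel [|\sum_J exp (2 i pi J . x)| ^ 2], where [J]
    runs over the box [{0, .., n - 1} ^ d], by
    [\sum_i cos (2 pi x_i) - (d - 1) - cos (2 pi e)].  The second factor is
    nonpositive as soon as one coordinate is [e]-far from the integers.  The
    constant term of the product, divided by the number of [J], is at least
    [d (1 - 1 / n) - (d - 1) - cos (2 pi e)], which is positive for large [n]. *)
Lemma trig_poly_localized (e : R) : 0 < e <= 4^-1 ->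
  exists2 L : seq (R * 'rV[int]_d), 0 < trig_mean L &
    forall x : 'cV[R]_d, (exists i, forall k : int, e < `|x i 0 - k%:~R|) ->
      trig_value L x <= 0.
Proof.
move=> e4; have /andP[e0 e1] := e4.
pose c := cos (2 * pi * e).
have pi0 := pi_gt0 R.
have c1 : c < 1.
  rewrite /c -[X in _ < X](cos0 R) ltr_cos ?in_itv /=; first by rewrite !mulr_gt0.
    by rewrite lexx ltW.
  by apply/andP; split; nra.
pose n := (Num.truncn (d%:R / (1 - c))).+1.
have n0 : 0 < n%:R :> R by rewrite ltr0n.
have nd : d%:R < n%:R * (1 - c).
  by rewrite -ltr_pdivrMr ?subr_gt0 // /n truncnS_gt.
pose a (J : {ffun 'I_d -> 'I_n}) x : R := 2 * pi * pairing (freq J) x.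
pose F (x : 'cV[R]_d) : R := \sum_(J : {ffun 'I_d -> 'I_n})
  \sum_(K : {ffun 'I_d -> 'I_n})
  (\sum_(i < d) (2^-1 * cos (2 * pi * pairing (freq J - freq K + delta_mx 0 i) x) +
   2^-1 * cos (2 * pi * pairing (freq J - freq K - delta_mx 0 i) x)) +
   (- (d%:R - 1 + c)) * cos (2 * pi * pairing (freq J - freq K) x)).
pose M : R := \sum_(J : {ffun 'I_d -> 'I_n}) \sum_(K : {ffun 'I_d -> 'I_n})
  (\sum_(i < d) (2^-1 * (freq J - freq K + delta_mx 0 i == 0)%:R +
    2^-1 * (freq J - freq K - delta_mx 0 i == 0)%:R) +
    (- (d%:R - 1 + c)) * (freq J - freq K == 0)%:R).
have [L FL Lc] : trig_poly F M.
  rewrite /F /M.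
  apply: trig_poly_sum => J; apply: trig_poly_sum => K.
  apply: trig_polyD; last exact: trig_poly_cos.
  by apply: trig_poly_sum => i; apply: trig_polyD; exact: trig_poly_cos.
exists L.
  rewrite -Lc.
  pose N : R := #|{: {ffun 'I_d -> 'I_n}}|%:R.
  have N0 : 0 < N.
    rewrite ltr0n; apply/card_gt0P; by exists [ffun=> ord0].
  pose S i : R := \sum_(J : {ffun 'I_d -> 'I_n})
    \sum_(K : {ffun 'I_d -> 'I_n}) (freq J - freq K + delta_mx 0 i == 0)%:R.
  have Sm i : S i = \sum_(J : {ffun 'I_d -> 'I_n})
      \sum_(K : {ffun 'I_d -> 'I_n}) (freq J - freq K - delta_mx 0 i == 0)%:R.
    rewrite exchange_big; apply: eq_bigr => J _; apply: eq_bigr => K _ /=.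
    by rewrite -[in RHS]oppr_eq0 !opprD !opprK [- freq K + _]addrC.
  have -> : M = \sum_(i < d) S i - (d%:R - 1 + c) * N.
    have -> : \sum_(i < d) S i = \sum_(i < d) (2^-1 * S i + 2^-1 * S i).
      by apply: eq_bigr => i _; lra.
    have -> : N = \sum_(J : {ffun 'I_d -> 'I_n}) \sum_(K : {ffun 'I_d -> 'I_n})
        (freq J - freq K == 0)%:R.
      rewrite /N -sum1_card natr_sum; apply: eq_bigr => J _.
      rewrite (bigD1 J) //= subrr eqxx big1 ?addr0 // => K KJ.
      by rewrite subr_eq0 (inj_eq (@freq_inj n)) eq_sym (negbTE KJ).
    have -> : \sum_(i < d) (2^-1 * S i + 2^-1 * S i) =
       \sum_(J : {ffun 'I_d -> 'I_n}) \sum_(K : {ffun 'I_d -> 'I_n})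
       \sum_(i < d) (2^-1 * (freq J - freq K + delta_mx 0 i == 0)%:R +
         2^-1 * (freq J - freq K - delta_mx 0 i == 0)%:R).
      rewrite (eq_bigr (fun i => \sum_(J : {ffun 'I_d -> 'I_n})
        \sum_(K : {ffun 'I_d -> 'I_n})
        (2^-1 * (freq J - freq K + delta_mx 0 i == 0)%:R +
         2^-1 * (freq J - freq K - delta_mx 0 i == 0)%:R))) => [|i _].
        rewrite exchange_big; apply: eq_bigr => J _ /=.
        by rewrite exchange_big.
      rewrite {2}Sm !mulr_sumr -big_split; apply: eq_bigr => J _ /=.
      by rewrite !mulr_sumr -big_split.
    rewrite -mulNr mulr_sumr -big_split; apply: eq_bigr => J _ /=.
    by rewrite mulr_sumr -big_split.
  have H : \sum_(i < d) ((n%:R - 1) * N) <= \sum_(i < d) (n%:R * S i).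
    by apply: ler_sum => i _; exact: count_unit_shifts.
  rewrite sumr_const card_ord -mulr_sumr -mulr_natl in H.
  rewrite -(pmulr_rgt0 _ n0); set SS := \sum_(i < d) S i in H *.
  nra.
move=> x [i Hi]; rewrite -FL.
have -> : F x = ((\sum_J cos (a J x)) ^+ 2 + (\sum_J sin (a J x)) ^+ 2) *
   (\sum_(i < d) cos (2 * pi * x i 0) - (d%:R - 1 + c)).
  rewrite !expr2 !mulr_suml -big_split mulr_suml; apply: eq_bigr => J _ /=.
  rewrite !mulr_sumr -big_split mulr_suml; apply: eq_bigr => K _ /=.
  rewrite -cosB mulrBr mulr_sumr -mulrN; congr (_ + _); last first.
    by rewrite mulrC /a pairingDl pairingNl; congr (cos _ * _); ring.
  apply: eq_bigr => l _.
  rewrite -!mulrDr !pairingDl !pairingNl pairing_delta.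
  set u := a J x; set v := a K x; set w := 2 * pi * x l 0.
  have -> : 2 * pi * (pairing (freq J) x - pairing (freq K) x + x l 0) = (u - v) + w.
    by rewrite /u /v /w /a; ring.
  have -> : 2 * pi * (pairing (freq J) x - pairing (freq K) x - x l 0) = (u - v) - w.
    by rewrite /u /v /w /a; ring.
  by rewrite (cosD (u - v) w) (cosB (u - v) w); field.
apply: mulr_ge0_le0; first by rewrite addr_ge0 // sqr_ge0.
rewrite (bigD1 i) //=.
have := cos_far_from_int e4 Hi; rewrite -/c.
have : \sum_(j < d | j != i) cos (2 * pi * x j 0) <= d%:R - 1.
  apply: (@le_trans _ _ (\sum_(j < d | j != i) 1)).
    by apply: ler_sum => j _; exact: cos_le1.
  rewrite sumr_const cardC1 card_ord -subn1 natrB //.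
  by case: (d) i {Hi} => // -[].
lra.
Qed.

End Fejer.

(** * Finite spanning families *)

Section Spans.

(** A free sequence of maximal length of elements of [P]. *)
Lemma finite_span (K : fieldType) (vT : vectType K) (P : vT -> Prop) :
  exists2 s : seq vT, (forall v, v \in s -> P v) &
    forall v, P v -> v \in span s.
Proof.
pose Q n := `[< exists s : seq vT, [/\ size s = n, free s & forall v, v \in s -> P v] >].
have Q0 : exists n, Q n by exists 0%N; apply/asboolP; exists [::]; rewrite nil_free.
have Qb n : Q n -> (n <= \dim {:vT})%N.
  move=> /asboolP[s [<- /eqP <- _]]; exact/dimvS/subvf.
case: (ex_maxnP Q0 Qb) => n /asboolP[s [sn fs Ps]] nmax.
exists s => // v Pv; apply: contrapT => /negP vs.
have /nmax : Q n.+1; last by rewrite ltnn.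
apply/asboolP; exists (v :: s); split; rewrite /= ?sn ?free_cons ?vs //.
by move=> w; rewrite in_cons => /orP[/eqP ->|/Ps].
Qed.

Lemma span_vanish (K : fieldType) (vT : vectType K) (W : lmodType K)
    (f : vT -> W) (s : seq vT) : linear f ->
  (forall v, v \in s -> f v = 0) -> forall v, v \in span s -> f v = 0.
Proof.
move=> fl; have f0 : f 0 = 0.
  by have := fl (-1) 0 0; rewrite scaler0 addr0 scaleN1r addNr.
elim: s => [|x s IH] fs v; first by rewrite span_nil memv0 => /eqP ->.
rewrite span_cons => /memv_addP[_ /vlineP[k ->] [w ws ->]].
rewrite fl fs ?mem_head // scaler0 add0r IH // => y ys.
by rewrite fs // in_cons ys orbT.
Qed.

End Spans.

(** * Polynomial families in a group generated by unipotents *)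

Section Families.
Variable d : nat.
Implicit Types (S G : set 'M[int]_d).

Lemma SLZ_generated_subgroup S : (forall u, S u -> \det u = 1) ->
  SLZ_subgroup (SLZ_generated S).
Proof.
move=> HS.
have unit1 (g : 'M[int]_d) : \det g = 1 -> g \in unitmx.
  by move=> g1; rewrite unitmxE g1 unitr1.
split.
- move=> g /(_ [set h | \det h = 1]); apply; split; last exact: HS.
  split=> [//||g1 g2 /=|h /= h1]; first exact: det1.
    by move=> H1 H2; rewrite det_mulmx H1 H2 mulr1.
  by rewrite det_inv h1 invr1.
- by move=> H [[]].
- move=> g h Hg Hh H HH; case: (HH) => -[_ _ HM _] _.
  by apply: HM; [exact: Hg|exact: Hh].
- by move=> g Hg H HH; case: (HH) => -[_ _ _ HV] _; apply: HV; exact: Hg.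
Qed.

Definition poly_family G (A : nmodType) (g : A -> 'M[int]_d) : Prop :=
  [/\ forall a, G (g a), g 0 = 1%:M & exists D, polydeg D g].

Lemma poly_family_mul G (A B : nmodType) (g : A -> 'M[int]_d)
    (h : B -> 'M[int]_d) : SLZ_subgroup G ->
  poly_family G g -> poly_family G h ->
  poly_family G (fun c : A * B => g c.1 *m h c.2).
Proof.
move=> [_ _ GM _] [Gg g0 [D gD]] [Gh h0 [E hE]]; split.
- by move=> c; apply: GM.
- by rewrite g0 h0 mulmx1.
exists (D + E)%N; apply: polydeg_mulmx.
  exact: (polydeg_comp (fst : {additive (A * B)%type -> A}) gD).
exact: (polydeg_comp (snd : {additive (A * B)%type -> B}) hE).
Qed.

Lemma poly_family_pow G (u : 'M[int]_d) : SLZ_subgroup G -> G u ->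
  unipotent u -> poly_family G (fun n : nat => u ^+ n).
Proof.
move=> [_ G1 GM _] Gu [n un]; split=> //.
  by elim=> [|k IH]; [exact: G1 | rewrite exprS; exact: GM].
exists n; have -> : (fun k : nat => u ^+ k) = fun k => 1 * u ^+ k.
  by apply/funext => k; rewrite mul1r.
by apply: polydeg_unipotent_pow; rewrite mul1r.
Qed.

Lemma unipotentV (u : 'M[int]_d) : u \in unitmx -> unipotent u -> unipotent (invmx u).
Proof.
move=> uU [n un]; exists n.
have c : GRing.comm (- invmx u) (u - 1%:M).
  rewrite /GRing.comm -!mulmxE mulmxBr mulmxBl mulmx1 mul1mx !mulNmx mulmxN.
  by rewrite mulVmx // mulmxV.
have -> : invmx u - 1%:M = - invmx u * (u - 1%:M).
  by rewrite -mulmxE mulmxBr mulmx1 mulNmx mulVmx // opprK addrC.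
by rewrite exprMn_comm // un mulr0.
Qed.

(** The pointwise inverse [g'] of the family is also required to be polynomial,
    so that the set of reached elements is closed under inversion. *)
Definition reached_by_family G (h : 'M[int]_d) : Prop :=
  exists (A : nmodType) (g g' : A -> 'M[int]_d) (a : A),
    [/\ poly_family G g, poly_family G g', forall b, g b *m g' b = 1%:M & g a = h].

(** The reached elements form a subgroup, products being reached by families
    indexed by product monoids, and the powers of a unipotent matrix form a
    polynomial family. *)
Lemma generated_reached_by_family S : (forall u, S u -> \det u = 1 /\ unipotent u) ->
  SLZ_generated S `<=` reached_by_family (SLZ_generated S).
Proof.
move=> HS; set G := SLZ_generated S.
have HG : SLZ_subgroup G by apply: SLZ_generated_subgroup => u /HS[].
have [Gdet G1 GM GV] := HG.
apply: smallest_sub; last first.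
  move=> u Su; have [u1 uu] := HS u Su.
  have Gu : G u by move=> H [_]; apply.
  have uU : u \in unitmx by rewrite unitmxE u1 unitr1.
  exists nat, (fun n => u ^+ n), (fun n => (invmx u) ^+ n), 1%N; split=> //.
  - exact: poly_family_pow.
  - by apply: poly_family_pow => //; [exact: GV | exact: unipotentV].
  elim=> [|k IH]; first by rewrite !expr0 -[1]/(1%:M) mulmx1.
  by rewrite exprSr exprS -!mulmxE -mulmxA (mulmxA u) mulmxV // mul1mx.
split.
- by move=> h [A [g [g' [a [[Gg _ _] _ _ <-]]]]]; exact: Gdet.
- exists nat, (fun=> 1%:M), (fun=> 1%:M), 0%N.
  by split=> //; [split=> //; exists 1%N; exact: polydeg_cst..|move=> _; rewrite mulmx1].
- move=> h1 h2 [A [g [gV [a [Hg HgV gK <-]]]]] [B [f [fV [b [Hf HfV fK <-]]]]].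
  exists (A * B)%type, (fun c : A * B => g c.1 *m f c.2).
  exists (fun c : A * B => fV c.2 *m gV c.1), (a, b); split=> //.
  - exact: poly_family_mul.
  - case: HgV HfV => [GgV gV0 [D gVD]] [GfV fV0 [E fVE]]; split.
    + by move=> c; apply: GM.
    + by rewrite fV0 gV0 mulmx1.
    exists (E + D)%N; apply: polydeg_mulmx.
      exact: (polydeg_comp (snd : {additive (A * B)%type -> B}) fVE).
    exact: (polydeg_comp (fst : {additive (A * B)%type -> A}) gVD).
  by move=> c; rewrite -mulmxA (mulmxA (f _)) fK mul1mx gK.
- move=> h [A [g [gV [a [Hg HgV gK <-]]]]].
  exists A, gV, g, a; split=> //; first by move=> b; apply: mulmx1C.
  have ga : g a \in unitmx by case: (mulmx1_unit (gK a)).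
  by rewrite -[LHS]mul1mx -(mulVmx ga) -mulmxA gK mulmx1.
Qed.

Variable R : realType.
Notation intmx := (map_mx (intr : int -> R)).

(** A single polynomial family sees the whole group linearly: choose finitely
    many [h] in the group such that the matrices [h - 1] span all of them, and
    multiply families that reach each of these [h]. *)
Lemma spanning_family S : (forall u, S u -> \det u = 1 /\ unipotent u) ->
  exists (A : nmodType) (g : A -> 'M[int]_d) (s : seq 'M[R]_d),
  [/\ poly_family (SLZ_generated S) g,
      forall M, M \in s -> exists a, M = intmx (g a) - 1%:M &
      forall h, SLZ_generated S h -> intmx h - 1%:M \in span s].
Proof.
move=> HS; set G := SLZ_generated S.
have HG : SLZ_subgroup G by apply: SLZ_generated_subgroup => u /HS[].
have [s sG sspan] := @finite_span R 'M[R]_d (fun M => exists2 h, G h & M = intmx h - 1%:M).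
suff [A [g [gF gs]]] : exists (A : nmodType) (g : A -> 'M[int]_d),
    poly_family G g /\ forall M, M \in s -> exists a, M = intmx (g a) - 1%:M.
  by exists A, g, s; split=> // h Gh; apply: sspan; exists h.
elim: s sG {sspan} => [|M s IH] sG.
  exists nat, (fun=> 1%:M); split=> //; split=> //; first by case: HG.
  by exists 1%N; exact: polydeg_cst.
have [|A [g [gF gs]]] := IH; first by move=> N Ns; apply: sG; rewrite in_cons Ns orbT.
have [h Gh Mh] := sG M (mem_head _ _).
have [B [f [_ [b [fF _ _ fb]]]]] := generated_reached_by_family HS Gh.
exists (A * B)%type, (fun c : A * B => g c.1 *m f c.2); split.
  exact: poly_family_mul.
have [[_ g0 _] [_ f0 _]] := (gF, fF).
move=> N; rewrite in_cons => /orP[/eqP ->|/gs[a ->]].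
  by exists (0, b); rewrite g0 mul1mx fb.
by exists (a, 0); rewrite f0 mulmx1.
Qed.

End Families.

(** * Differences along which a polynomial orbit fails to average out *)

Section Rigidity.
Variables (R : realType) (d : nat).
Notation intmx := (map_mx (intr : int -> R)).
Implicit Types (m : 'rV[int]_d) (v w : 'cV[R]_d).

Lemma pairing_linear m (M : 'M[R]_d) : linear (fun v => pairing m (M *m v) : R^o).
Proof. by move=> a u v; rewrite /pairing mulmxDr -scalemxAr mulmxDr -scalemxAr !mxE. Qed.

Lemma pairing_linearl m v : linear (fun M : 'M[R]_d => pairing m (M *m v) : R^o).
Proof. by move=> a M N; rewrite /pairing mulmxDl -scalemxAl mulmxDr -scalemxAr !mxE. Qed.

Lemma polydeg_orbit (A : nmodType) (g : A -> 'M[int]_d) D m v :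
  polydeg D g -> polydeg D (fun a => pairing m (lin_act (g a) v)).
Proof.
move=> gD; apply: (@polydeg_additive _ _ _ _ _ (fun M => pairing m (lin_act M v))) gD.
by move=> M N; rewrite /lin_act map_mxB mulmxBl pairingDr pairingNr.
Qed.

Lemma pairing_lin_act1 m v : pairing m (lin_act 1%:M v) = pairing m v.
Proof. by rewrite /lin_act map_mx1 mul1mx. Qed.

Lemma lin_actM g h v : lin_act (g *m h) v = lin_act g (lin_act h v).
Proof. by rewrite /lin_act map_mxM mulmxA. Qed.

(** The set of all [v] with [m . h v = m . w] for every [h] in [G] is an
    invariant affine subspace through [w]; it is proper because [m] is not
    zero. *)
Lemma invariant_level_set (G : set 'M[int]_d) m w :
  G 1%:M -> (forall g h, G g -> G h -> G (g *m h)) -> m != 0 ->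
  (forall h, G h -> pairing m (lin_act h w) = pairing m w) ->
  exists A, [/\ proper_affine A, invariant_under G A & A w].
Proof.
move=> G1 GM m0 mw.
exists [set v | forall h, G h -> pairing m (lin_act h v) = pairing m w]; split.
- split; last first.
    move=> AT; have mw0 : pairing m w = 0.
      have : [set: 'cV[R]_d] 0 by []; rewrite -AT => /(_ _ G1) <-.
      by rewrite pairing_lin_act1 /pairing mulmx0 mxE.
    case/eqP: m0; apply/rowP => i; rewrite mxE; apply/eqP.
    rewrite -(intr_eq0 R); apply/eqP.
    have : [set: 'cV[R]_d] (delta_mx i 0) by [].
    rewrite -AT => /(_ _ G1); rewrite pairing_lin_act1 mw0 => <-.
    by rewrite /pairing -colE !mxE.
  have [s sP sspan] := @finite_span R 'cV[R]_d
    (fun v => forall h, G h -> pairing m (lin_act h v) = 0).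
  exists (span s), w; apply/seteqP; split=> [v Hv|_ [u us <-] h Gh].
    exists (v - w); last by rewrite subrK.
    apply: sspan => h Gh.
    by rewrite /lin_act mulmxBr pairingDr pairingNr [X in X - _]Hv // mw // subrr.
  rewrite /lin_act mulmxDr pairingDr [X in _ + X]mw //.
  rewrite (span_vanish (pairing_linear m (intmx h)) _ us) ?add0r // => x xs.
  exact: sP.
- by move=> g Gg _ [v Hv <-] h Gh; rewrite -lin_actM Hv //; exact: GM.
- by [].
Qed.

(** Infinite pigeonhole principle, applied to one function after the other. *)
Lemma pigeonhole_int_valued (T : Type) (I : eqType) (r : seq I)
    (f : I -> T -> R) (B : set T) : infinite_set B ->
  (forall i y, i \in r -> B y -> f i y \is a Num.int) ->
  (forall i, i \in r -> exists C : R, forall y, B y -> `|f i y| <= C) ->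
  exists B', [/\ infinite_set B', B' `<=` B &
     forall i y y', i \in r -> B' y -> B' y' -> f i y = f i y'].
Proof.
elim: r B => [|j r IH] B Binf BZ BC.
  by exists B; split=> [//|y //|i y y'].
have [C fC] := BC j (mem_head _ _).
pose K := Num.truncn `|C|.
pose vals : seq R := [seq i%:R - K%:R | i <- iota 0 (K + K).+1].
have [c cinf] : exists c, infinite_set (B `&` [set y | f j y = c]).
  apply: contrapT => /forallNP Hfin; apply: Binf.
  have -> : B = \bigcup_(c in [set` vals]) (B `&` [set y | f j y = c]).
    apply/seteqP; split=> [y By|y [c _ []]] //.
    exists (f j y) => //=.
    have /intrP[z Hz] := BZ j y (mem_head j r) By.
    have zK : `|z| < K.+1%:Z.
      rewrite -(ltr_int R) intr_norm -Hz; apply: (le_lt_trans (fC y By)).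
      exact: le_lt_trans (ler_norm _) (truncnS_gt _).
    apply/mapP; exists (absz (z + K%:Z)); first by rewrite mem_iota; lia.
    by rewrite Hz natr_absz ger0_norm ?intrD ?addrK //; lia.
  apply: bigcup_finite; first exact: finite_seq.
  by move=> c _; have /contrapT := Hfin c.
have [||B' [B'inf B'B HB']] := IH _ cinf.
- by move=> i y ir [By _]; apply: BZ; rewrite // in_cons ir orbT.
- move=> i ir; have [|C' gC] := BC i; first by rewrite in_cons ir orbT.
  by exists C' => y [By _]; exact: gC.
exists B'; split=> //; first by move=> y /B'B[].
move=> i y y'; rewrite in_cons => /orP[/eqP ->|]; last exact: HB'.
by move=> /B'B[_ ->] /B'B[_ ->].
Qed.

Lemma pairing_bound m (M : 'M[R]_d) : exists C : R, forall v,
  (forall i, `|v i 0| <= 1) -> `|pairing m (M *m v)| <= C.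
Proof.
exists (\sum_i `|(intmx m *m M) 0 i|) => v Hv.
rewrite /pairing mulmxA mxE; apply: (le_trans (ler_norm_sum _ _ _)).
by apply: ler_sum => i _; rewrite normrM ler_piMr.
Qed.

(** All real multiples of [p] are periodic modulo one, so by
    [periodic_mod1_torsion] all real multiples of [Q ^ D * (p x - p 0)] are
    integers. *)
Lemma periodic_constant (A : nmodType) (Q D : nat) (p : A -> R) : (0 < Q)%N ->
  polydeg D p -> (forall x y, p (x + y *+ Q) = p x) -> forall x, p x = p 0.
Proof.
move=> Q0 pD pQ x; apply/eqP; rewrite -subr_eq0; apply/negPn/negP => px.
have QD : (Q ^ D)%:R != 0 :> R by rewrite pnatr_eq0 -lt0n expn_gt0 Q0.
(* The multiple for which [Q ^ D * (l * p x - l * p 0)] is one half. *)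
pose l : R := 2^-1 / ((Q ^ D)%:R * (p x - p 0)).
have lD : polydeg D (fun a => l * p a).
  by apply: (@polydeg_additive _ _ _ _ _ (fun z => l * z)) pD => u v; rewrite mulrBr.
have lQ : periodic_mod1 Q (fun a => l * p a) by move=> a b; rewrite pQ subrr.
have := periodic_mod1_torsion lD lQ x.
have -> : (Q ^ D)%:R * (l * p x - l * p 0) = 2^-1.
  by rewrite -mulrBr /l; field; rewrite px.
move=> /intrP[z Hz].
have : (2 * z)%:~R = 1%:~R :> R by rewrite intrM -Hz mulfV.
by move=> /eqP; rewrite eqr_int => /eqP; lia.
Qed.

(** If the averages attached to [y - y0] are not small, then by [weyl_periodic]
    the numbers [m . (g (x + a *+ Q) - g x) (y - y0)] are integers, and they are
    bounded since the points lie in the unit cube.  Were this so for infinitely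
    many [y], two of them, [y] and [y'], would give the same integers for a
    finite spanning set of the matrices [g (x + a *+ Q) - g x].  Hence
    [m . g a (y' - y)] is exactly periodic in [a], therefore constant, and the
    spanning property of [g] makes [m . h (y' - y)] independent of [h] in [G]:
    then [y' - y] lies in a proper invariant affine subspace. *)
Lemma finite_exceptional (A : nmodType) (g : A -> 'M[int]_d) (s : seq 'M[R]_d)
    (G : set 'M[int]_d) (Yt : set 'cV[R]_d) (dl : R) m y0 :
  G 1%:M -> (forall g h, G g -> G h -> G (g *m h)) ->
  Yt `<=` @half_open_cube R d ->
  (forall y y', Yt y -> Yt y' -> y <> y' ->
     ~ exists A : set 'cV[R]_d,
         [/\ proper_affine A, invariant_under G A & A (y - y')]) ->
  poly_family G g ->
  (forall M, M \in s -> exists a, M = intmx (g a) - 1%:M) ->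
  (forall h, G h -> intmx h - 1%:M \in span s) ->
  0 < dl -> m != 0 -> Yt y0 ->
  finite_set [set y | Yt y /\
    ~ small_average dl (fun a => pairing m (lin_act (g a) (y - y0)))].
Proof.
move=> G1 GM hYt hsep [Gg g0 [D gD]] sg sspan dl0 m0 Yy0.
apply: contrapT => Binf.
have [Q Q0 HQ] := @weyl_periodic R D dl dl0.
have [t tP tspan] := @finite_span R 'M[R]_d
  (fun M => exists x a, M = intmx (g (x + a *+ Q)) - intmx (g x)).
have [||B' [B'inf B'B HB']] := @pigeonhole_int_valued _ _ t
  (fun M y => pairing m (M *m (y - y0))) _ Binf.
- move=> M y Mt [Yy ny]; have [x [a ->]] := tP M Mt.
  have := HQ _ _ (polydeg_orbit m (y - y0) gD) ny x a.
  by rewrite mulmxBl pairingDr pairingNr.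
- move=> M Mt; have [C HC] := pairing_bound m M; exists C => y [Yy _]; apply: HC => i.
  by have := hYt _ Yy i; have := hYt _ Yy0 i; rewrite !mxE ler_norml; lra.
have [y B'y] := infinite_setN0 B'inf.
have [y' [B'y' yy']] : exists y', B' y' /\ y' <> y.
  apply: contrapT => /forallNP H; apply: B'inf.
  apply: (sub_finite_set _ (finite_set1 y)) => z Bz.
  by apply: contrapT => zy; apply: (H z).
have [Yy _] := B'B _ B'y; have [Yy' _] := B'B _ B'y'.
apply: (hsep _ _ Yy' Yy yy'); apply: (@invariant_level_set G m) => // h Gh.
have tw : forall M, M \in span t -> pairing m (M *m (y' - y)) = 0.
  apply: (span_vanish (pairing_linearl m (y' - y))) => M Mt.
  have -> : y' - y = (y' - y0) - (y - y0) by rewrite opprB addrA subrK.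
  by rewrite mulmxBr pairingDr pairingNr (HB' M y' y) // subrr.
have cst : forall a, pairing m (lin_act (g a) (y' - y)) = pairing m (y' - y).
  move=> a; rewrite (periodic_constant Q0 (polydeg_orbit m (y' - y) gD)).
    by rewrite g0 pairing_lin_act1.
  move=> x b; apply/eqP; rewrite -subr_eq0 -pairingNr -pairingDr -mulmxBl.
  by apply/eqP/tw/tspan; exists x, b.
apply/eqP; rewrite -subr_eq0 -pairingNr -pairingDr -[X in _ - X]mul1mx -mulmxBl.
apply/eqP; apply: (span_vanish (pairing_linearl m (y' - y))) (sspan _ Gh) => M /sg[a ->].
by rewrite mulmxBl pairingDr pairingNr cst mul1mx subrr.
Qed.

End Rigidity.

(** * Second moment and density *)

Section Density.
Variable R : realType.

Lemma greedy_selection (T : Type) (Y : set T) (bad : T -> T -> Prop) :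
  infinite_set Y -> (forall y0, Y y0 -> finite_set [set y | Y y /\ bad y0 y]) ->
  forall k, exists y : nat -> T, (forall i, (i < k)%N -> Y (y i)) /\
    forall i j, (i < j < k)%N -> ~ bad (y i) (y j).
Proof.
move=> Yinf Hbad; elim=> [|k [y [yY ybad]]].
  by have [y0 _] := infinite_setN0 Yinf; exists (fun=> y0); split=> // i j; lia.
have [z [Yz zbad]] : exists z, Y z /\ forall i, (i < k)%N -> ~ bad (y i) z.
  apply: contrapT => /forallNP H; apply: Yinf.
  apply: (@sub_finite_set _ _ (\bigcup_(i in `I_k) [set z | Y z /\ bad (y i) z])).
    move=> z Yz; apply: contrapT => zn; apply: (H z); split=> // i ik bz.
    by apply: zn; exists i.
  apply: bigcup_finite; first exact: finite_II.
  by move=> i ik; apply: Hbad; exact: yY.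
exists (fun i => if i == k then z else y i); split=> [i|i j].
  by rewrite ltnS leq_eqVlt; case: eqP => //= _; exact: yY.
move=> /andP[ij]; rewrite ltnS => jk.
have ik : (i < k)%N by exact: leq_trans jk.
rewrite (ltn_eqF ik); case: eqP => [_|jk']; first exact: zbad.
by apply: ybad; rewrite ij ltn_neqAle jk andbT; apply/eqP.
Qed.

Lemma exists_le_mean (I : eqType) (s : seq I) (F : I -> R) (c c' : R) :
  s != [::] -> c < c' -> \sum_(i <- s) F i <= c * (size s)%:R ->
  exists2 i, i \in s & F i <= c'.
Proof.
move=> s0 cc' H; apply: contrapT => Hn.
have : \sum_(i <- s) - F i <= - c' * (size s)%:R.
  apply: sum_le_size => i si; rewrite lerN2 leNgt; apply/negP => /ltW Fi.
  by apply: Hn; exists i.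
rewrite sumrN mulNr lerN2 => H'.
have : 0 < (size s)%:R :> R by rewrite ltr0n lt0n size_eq0.
nra.
Qed.

(** Choose [k] points of [Yt] such that no pair is exceptional, for any of the
    frequencies [ms].  A common finite set of shifts makes the averages over [a]
    of [cos (2 pi m . g a (y i - y j))] at most [dl] for all [i != j].  So the
    second moment [|\sum_i exp (2 i pi m . g a (y i))| ^ 2] has an average over
    [a] of at most [k + dl * k ^ 2], and one value of [a] is good for all [m]. *)
Lemma orbit_second_moment (d : nat) (Yt : set 'cV[R]_d)
    (A : nmodType) (g : A -> 'M[int]_d) (ms : seq 'rV[int]_d) (eta : R) :
  infinite_set Yt -> 0 < eta ->
  (forall m dl y0, m \in ms -> 0 < dl -> Yt y0 ->
    finite_set [set y | Yt y /\
    ~ small_average dl (fun a => pairing m (lin_act (g a) (y - y0)))]) ->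
  exists (k : nat) (y : nat -> 'cV[R]_d) (a : A),
    [/\ (0 < k)%N, forall i, (i < k)%N -> Yt (y i) &
      forall m th, m \in ms ->
        `|\sum_(i <- iota 0 k) cos (2 * pi * pairing m (lin_act (g a) (y i)) + th)|
          <= eta * k%:R].
Proof.
move=> Yinf eta0 Hfin.
pose N : R := (size ms)%:R.
have N0 : 0 <= N by exact: ler0n.
pose dl := eta ^+ 2 / (2 * (N + 1)).
have dl0 : 0 < dl by rewrite divr_gt0 ?exprn_gt0 //; lra.
have dlE : dl * (2 * (N + 1)) = eta ^+ 2 by rewrite /dl mulfVK // gt_eqF //; lra.
have [k k0 k1] : exists2 k : nat, 0 < k%:R :> R & 1 < dl * k%:R.
  exists (Num.truncn dl^-1).+1; first by rewrite ltr0n.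
  by rewrite -ltr_pdivrMl // mulr1 truncnS_gt.
have [|y [yY ygood]] := @greedy_selection _ Yt
  (fun y0 y => exists2 m, m \in ms &
     ~ small_average dl (fun a => pairing m (lin_act (g a) (y - y0)))) Yinf _ k.
  move=> y0 Yy0.
  apply: (@sub_finite_set _ _ (\bigcup_(m in [set` ms])
    [set y | Yt y /\
      ~ small_average dl (fun a => pairing m (lin_act (g a) (y - y0)))])).
    by move=> y [Yy [m mm nm]]; exists m.
  apply: bigcup_finite; first exact: finite_seq.
  by move=> m mm; exact: Hfin.
pose r := [seq x <- [seq (ij, m) |
   ij <- [seq (i, j) | i <- iota 0 k, j <- iota 0 k], m <- ms] | (x.1.1 < x.1.2)%N].
have rP i j m : (i < j < k)%N -> m \in ms -> ((i, j), m) \in r.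
  move=> ijk mm; rewrite mem_filter /=; apply/andP; split; first by lia.
  apply/allpairsP; exists ((i, j), m); split=> //=.
  by apply/allpairsP; exists (i, j); rewrite /= !mem_iota; split=> //; lia.
have [|s s0 Hs] := @small_average_on_common R dl A _ r
    (fun x a => pairing x.2 (lin_act (g a) (y x.1.2 - y x.1.1))).
  move=> [[i j] m]; rewrite mem_filter => /andP[/= ij].
  move=> /allpairsP[[_ m'] [/= /allpairsP[[i' j'] /= [_ jk ->]] mm [Ei Ej Em]]].
  rewrite {}Ei {}Ej {}Em in ij *; move: jk; rewrite mem_iota add0n => jk.
  apply: contrapT => ns; apply: (ygood i' j'); last by exists m'.
  by rewrite ij; case/andP: jk.
pose e m a i : R := 2 * pi * pairing m (lin_act (g a) (y i)).
pose W m a : R := \sum_(i <- iota 0 k) \sum_(j <- iota 0 k) cos (e m a i - e m a j).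
have pairs m i j : m \in ms -> i \in iota 0 k -> j \in iota 0 k ->
    \sum_(a <- s) cos (e m a i - e m a j) <= (size s)%:R * ((j == i)%:R + dl).
  move=> mm; rewrite !mem_iota /= !add0n => ik jk.
  have lt i' j' : (i' < j' < k)%N ->
      \sum_(a <- s) cos (e m a j' - e m a i') <= dl * (size s)%:R.
    move=> ij; have := Hs _ (rP i' j' m ij mm) 0 0.
    congr (_ <= _); apply: eq_bigr => a _; rewrite add0r addr0 /= /e.
    by rewrite /lin_act mulmxBr pairingDr pairingNr mulrBr.
  have n0 : 0 <= (size s)%:R :> R by exact: ler0n.
  have [->|ji] := eqVneq j i.
    rewrite (eq_bigr (fun => 1)) => [|a _]; last by rewrite subrr cos0.
    rewrite big_const_seq count_predT iter_addr_0 /=; nra.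
  rewrite add0r mulrC.
  have [ij|ij] := ltnP i j.
    have := lt i j; rewrite ij jk => /(_ isT); congr (_ <= _).
    by apply: eq_bigr => a _; rewrite -cosN opprB.
  by apply: lt; rewrite ik andbT ltn_neqAle ji.
have Wsum m : m \in ms ->
    \sum_(a <- s) W m a <= (k%:R * (1 + dl * k%:R)) * (size s)%:R.
  move=> mm; rewrite exchange_big /=.
  rewrite (_ : k%:R * _ * _ =
      ((size s)%:R * (1 + dl * k%:R)) * (size (iota 0 k))%:R); last first.
    by rewrite size_iota; ring.
  apply: sum_le_size => i ik; rewrite exchange_big /=.
  apply: (@le_trans _ _ (\sum_(j <- iota 0 k) (size s)%:R * ((j == i)%:R + dl))).
    by rewrite big_seq [X in _ <= X]big_seq; apply: ler_sum => j jk; exact: pairs.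
  rewrite -mulr_sumr ler_wpM2l ?ler0n // big_split /= lerD //.
    rewrite -natr_sum -[X in _ <= X]/(1%:R) ler_nat -big_mkcond sum1_count.
    by rewrite count_uniq_mem ?iota_uniq //; case: (_ \in _).
  by rewrite -[X in _ * X%:R](size_iota 0); exact: sum_le_size.
have [||a _ Ha] := @exists_le_mean A s (fun a => \sum_(m <- ms) W m a)
   (N * (k%:R * (1 + dl * k%:R))) ((eta * k%:R) ^+ 2) s0.
- rewrite exprMn -dlE.
  have : 0 <= N * k%:R * (dl * k%:R - 1)
    by rewrite !mulr_ge0 ?(ltW k0) // subr_ge0 ltW.
  have : 0 < dl * k%:R ^+ 2 by rewrite mulr_gt0 ?exprn_gt0.
  lra.
- rewrite exchange_big /= -mulrA mulrC.
  rewrite big_seq; apply: (le_trans (ler_sum _ (fun m mm => Wsum m mm))).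
  by rewrite -big_seq; apply: sum_le_size.
exists k, y, a; split=> // [|m th mm]; first by rewrite -(ltr0n R).
have W0 m' : 0 <= W m' a by apply: (le_trans (sqr_ge0 _) (cos_sum_sq _ _ 0)).
rewrite -(@ler_pXn2r _ 2) ?nnegrE ?normr_ge0 ?mulr_ge0 ?(ltW eta0) ?(ltW k0) //.
rewrite real_normK ?num_real //; apply: (le_trans (cos_sum_sq _ _ th)).
apply: le_trans Ha; rewrite (big_rem m) //= lerDl.
by apply: sumr_ge0 => m' _; exact: W0.
Qed.

Lemma torus_norm_le (d : nat) (v : 'cV[R]_d) (e : R) : 0 <= e ->
  (forall i, exists n : int, `|v i 0 - n%:~R| <= e) ->
  torus_norm (torus_proj v) <= e.
Proof.
move=> e0 Hv.
have [n Hn] : exists n : 'I_d -> int, forall i, `|v i 0 - (n i)%:~R| <= e.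
  by exists (fun i => projT1 (cid (Hv i))) => i; exact: projT2 (cid (Hv i)).
pose u : 'cV[R]_d := \col_i (v i 0 - (n i)%:~R).
have ue : `|u| <= e.
  rewrite [`|u|]mx_normrE; apply: bigmax_le => // -[i j] _ /=.
  by rewrite ord1 mxE.
apply: (le_trans _ ue); apply: ge_inf.
  by exists 0 => _ [w _ <-]; exact: normr_ge0.
exists u => //=; apply/torus_projE/forallP => i; rewrite !mxE addrAC subrr add0r.
by rewrite rpredN intr_int.
Qed.

End Density.

Theorem theoremC (R : realType) (d : nat)
  (U : seq 'M[int]_d) (G : set 'M[int]_d) (Yt : set 'cV[R]_d)
  (hU : forall u, u \in U -> \det u = 1 /\ unipotent u)
  (hG : G = SLZ_generated [set` U])
  (hYt : Yt `<=` @half_open_cube R d)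
  (hinf : infinite_set Yt)
  (hsep : forall y y', Yt y -> Yt y' -> y <> y' ->
     ~ exists A : set 'cV[R]_d,
         [/\ proper_affine A, invariant_under G A & A (y - y')]) :
  forall eps : R, 0 < eps ->
  exists k : nat, (`I_k.+1 #<= Yt)%card ->
  exists2 g, G g & eps_dense eps (torus_act g @` (@torus_proj R d @` Yt)).
Proof.
(* Since [Yt] is infinite, every bound on its cardinality is exceeded. *)
move=> eps eps0; exists 0%N => _.
pose e := Num.min eps 4^-1.
have e4 : 0 < e <= 4^-1.
  by rewrite lt_min eps0 ge_min lexx orbT invr_gt0 ltr0n.
have ee : e <= eps by rewrite ge_min lexx.
have HG : SLZ_subgroup G by rewrite hG; apply: SLZ_generated_subgroup => u /hU[].
have [_ G1 GM _] := HG.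
have [L c0 HL] := @trig_poly_localized R d e e4.
have [A [g [s [gF sg sspan]]]] := @spanning_family d R [set` U] hU.
rewrite -hG in gF sspan.
pose C : R := \sum_(l <- L) `|l.1|.
have C0 : 0 <= C by apply: sumr_ge0 => l _; exact: normr_ge0.
pose eta := trig_mean L / (C + 1).
have etaE : eta * (C + 1) = trig_mean L by rewrite /eta mulfVK // gt_eqF //; lra.
have eta0 : 0 < eta by rewrite divr_gt0 //; lra.
pose ms := [seq l.2 | l <- L & l.2 != 0].
have Hfin m dl y0 : m \in ms -> 0 < dl -> Yt y0 -> finite_set
    [set y | Yt y /\
      ~ small_average dl (fun a => pairing m (lin_act (g a) (y - y0)))].
  move=> /mapP[l]; rewrite mem_filter => /andP[l0 _] -> dl0 Yy0.
  exact: (finite_exceptional G1 GM hYt hsep gF sg sspan).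
have [k [y [a [k0 yY Hya]]]] := orbit_second_moment hinf eta0 Hfin.
exists (g a); first by case: gF.
move=> al; pose v := torus_lift al.
have [i ik Hi] : exists2 i, (i < k)%N & forall l, exists n : int,
   `|(v - lin_act (g a) (y i)) l 0 - n%:~R| <= e.
  (* Otherwise the sum over the [k] points of the localized trigonometric
     polynomial centred at [v] is nonpositive, although its constant term
     outweighs the other frequencies, which are at most [eta * k] each. *)
  apply: contrapT => Hn.
  have le0 : \sum_(i <- iota 0 k) trig_value L (v - lin_act (g a) (y i)) <= 0.
    rewrite big_seq; apply: sumr_le0 => i; rewrite mem_iota add0n /= => ik.
    apply: HL; apply: contrapT => /forallNP Hi; apply: Hn; exists i => // l.
    apply: contrapT => /forallNP Hl; apply: (Hi l) => n.
    by rewrite ltNge; apply/negP/Hl.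
  have : \sum_(l <- L) (if l.2 == 0 then l.1 * k%:R else - (eta * k%:R * `|l.1|)) <=
      \sum_(i <- iota 0 k) trig_value L (v - lin_act (g a) (y i)).
    rewrite exchange_big /= big_seq [X in _ <= X]big_seq; apply: ler_sum => l lL.
    rewrite -mulr_sumr; case: eqP => [->|/eqP l0].
      rewrite (eq_bigr (fun => 1)) => [|i _].
        by rewrite big_const_seq count_predT iter_addr_0 size_iota.
      by rewrite /pairing map_mx0 mul0mx mxE mulr0 cos0.
    have lm : l.2 \in ms by apply/mapP; exists l => //; rewrite mem_filter l0.
    rewrite (eq_bigr (fun i => cos (2 * pi * pairing l.2 (lin_act (g a) (y i)) +
      - (2 * pi * pairing l.2 v)))) => [|i _]; last first.
      by rewrite -cosN pairingDr pairingNr; congr cos; ring.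
    have := Hya _ (- (2 * pi * pairing l.2 v)) lm.
    set Sl := \sum_(i <- _) _ => HS.
    have : `|l.1 * Sl| <= eta * k%:R * `|l.1|.
      by rewrite normrM mulrC ler_wpM2r.
    by rewrite ler_norml => /andP[].
  apply/negP; rewrite -ltNge; apply: (le_lt_trans le0).
  have -> : \sum_(l <- L) (if l.2 == 0 then l.1 * k%:R else - (eta * k%:R * `|l.1|)) =
     trig_mean L * k%:R - eta * k%:R * (\sum_(l <- L | l.2 != 0) `|l.1|).
    rewrite (bigID (fun l => l.2 == 0)) /= /trig_mean mulr_suml mulr_sumr -sumrN.
    by congr (_ + _); apply: eq_bigr => l; [move=> ->|move=> /negbTE ->].
  have CC : \sum_(l <- L | l.2 != 0) `|l.1| <= C.
    by rewrite /C [X in _ <= X](bigID (fun l => l.2 != 0)) /= lerDl sumr_ge0.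
  have k1 : 0 < k%:R :> R by rewrite ltr0n.
  rewrite -mulrA (mulrC k%:R) mulrA -mulrBl mulr_gt0 // -etaE; nra.
exists (torus_proj (lin_act (g a) (y i))).
  exists (torus_proj (y i)); last exact: torus_actE.
  by exists (y i) => //; exact: yY.
rewrite -[al]torus_liftK -torus_projB; apply: le_trans ee.
by apply: torus_norm_le => //; case/andP: e4 => /ltW.
Qed.
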